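(* The antipode of the Hopf monoid of hypergraphs $\mathbf{HG}$ is given by the following cancellation-free and grouping-free expression. If $\mathcal H$ is a hypergraph on $I$ then $$\mathsf s_I(\mathcal H)=\sum_{\Delta_{\mathcal G}\le\Delta_{\mathcal H}}(-1)^{c(\mathcal G)}\,\mathcal G,$$ summing over all (nonempty) faces $\Delta_{\mathcal G}$ of the hypergraphic polytope $\Delta_{\mathcal H}$ of $\mathcal H$, where $c(\mathcal G)$ is the number of connected components of the hypergraph $\mathcal G$.
   Context: A hypergraph on a finite set $I$ is a finite collection $\mathcal H$ of (possibly repeated) subsets of $I$, called multiedges, with the convention that $\emptyset$ appears exactly once. $\mathrm{HG}[I]$ is the set of hypergraphs on $I$; $\mathbf{HG}[I]$ is the vector space with basis $\mathrm{HG}[I]$ over a field of characteristic $0$. For an ordered decomposition $I=S\sqcup T$, the product of $\mathcal H_1\in \mathrm{HG}[S]$ and $\mathcal H_2\in \mathrm{HG}[T]$ is their disjoint union (with a single copy of $\emptyset$), and the coproduct is $\Delta_{S,T}(\mathcal H)=\mathcal H|_S\otimes\mathcal H/_S$, where, as multisets, $\mathcal H|_S=\{H\in\mathcal H:H\subseteq S\}$ and $\mathcal H/_S=\{H\cap T:H\in\mathcal H,\ H\not\subseteq S\}\cup\{\emptyset\}$ (multiplicities retained, so the multiplicity of a nonempty $K\subseteq T$ in $\mathcal H/_S$ is the total multiplicity of those $H\in\mathcal H$ with $H\cap T=K$). These make $\mathbf{HG}$ a connected Hopf monoid. With $\mu_{S_1,\dots,S_k},\Delta_{S_1,\dots,S_k}$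 the iterated (co)products, the antipode is $\mathsf s_\emptyset=\mathrm{id}$ and, for $I\neq\emptyset$, $\mathsf s_I=\sum(-1)^k\mu_{S_1,\dots,S_k}\circ\Delta_{S_1,\dots,S_k}$, over all $k\ge1$ and ordered sequences of nonempty pairwise disjoint $S_1,\dots,S_k$ with union $I$. The hypergraphic polytope of $\mathcal H$ is the Minkowski sum $\Delta_{\mathcal H}=\sum_{H\in\mathcal H}\Delta_H\subset\mathbb RI$ (with multiplicity), where $\Delta_H=\mathrm{conv}\{e_i:i\in H\}$ for $H\ne\emptyset$ and the empty multiedge contributes nothing. The map $\mathcal H\mapsto\Delta_{\mathcal H}$ is injective, and every nonempty face of $\Delta_{\mathcal H}$ is of the form $\Delta_{\mathcal G}$ for a unique hypergraph $\mathcal G$ on $I$. The connected components of $\mathcal G$ are the blocks of the finest partition of $I$ such that every multiedge of $\mathcal G$ is contained in a block. An expression $\sum_\alpha c_\alpha x_\alpha$ in basis elements is cancellation-free if no $\alpha\ne\beta$ have $x_\alpha=x_\beta$ with $c_\alpha,c_\beta$ of opposite sign, and grouping-free if the $x_\alpha$ are pairwise distinct. *)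

(* Defs.v *)
From HB Require Import structures.
From mathcomp Require Import all_boot all_order all_algebra.
From mathcomp.multinomials Require Import freeg.

Set Implicit Arguments.
Unset Strict Implicit.
Unset Printing Implicit Defensive.

Import Order.TTheory GRing.Theory Num.Theory.

Local Open Scope ring_scope.

Section Hypergraphs.
Variable I : finType.
Implicit Types S T A B : {set I}.

(* A finite multiset of subsets of S is given by its multiplicity function. *)
Definition is_hypergraph S (m : {ffun {set I} -> nat}) : bool :=
  (m set0 == 1)%N && [forall A : {set I}, (0 < m A)%N ==> (A \subset S)].

Record hypergraph S := Hypergraph {
  mult :> {ffun {set I} -> nat};
  _ : is_hypergraph S mult }.

HB.instance Definition _ S := [isSub for @mult S].
HB.instance Definition _ S := [Choice of hypergraph S by <:].

Fact empty_hypergraph_subproof S :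
  is_hypergraph S [ffun A : {set I} => (A == set0) : nat].
Proof.
rewrite /is_hypergraph ffunE eqxx; apply/forallP => A; rewrite ffunE.
by case: eqP => [->|_] //=; rewrite sub0set.
Qed.

Definition empty_hypergraph S : hypergraph S :=
  Hypergraph (empty_hypergraph_subproof S).

(* The (co)product is only meant for disjoint S and T. *)

Fact disjoint_union_subproof S T (G1 : hypergraph S) (G2 : hypergraph T) :
  is_hypergraph (S :|: T)
    [ffun A : {set I} => if A == set0 then 1%N else (G1 A + G2 A)%N].
Proof.
case: G1 G2 => [m1 /andP[_ /forallP h1]] [m2 /andP[_ /forallP h2]] /=.
rewrite /is_hypergraph ffunE eqxx; apply/forallP => A; rewrite ffunE.
case: eqP => [->|_]; first by rewrite sub0set.
rewrite addn_gt0; apply/implyP => /orP[/(implyP (h1 A))|/(implyP (h2 A))] sA.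
  exact: subset_trans sA (subsetUl _ _).
exact: subset_trans sA (subsetUr _ _).
Qed.

Definition disjoint_union S T (G1 : hypergraph S) (G2 : hypergraph T) :
  hypergraph (S :|: T) := Hypergraph (disjoint_union_subproof G1 G2).

Fact restriction_subproof S T (H : hypergraph (S :|: T)) :
  is_hypergraph S [ffun A : {set I} => if A \subset S then H A else 0%N].
Proof.
case: H => [m /andP[/eqP m0 _]] /=.
rewrite /is_hypergraph ffunE sub0set m0 eqxx; apply/forallP => A.
by rewrite ffunE; case: ifP => _; rewrite ?implybT.
Qed.

Definition restriction S T (H : hypergraph (S :|: T)) : hypergraph S :=
  Hypergraph (restriction_subproof H).

Fact contraction_subproof S T (H : hypergraph (S :|: T)) :
  is_hypergraph T [ffun A : {set I} => if A == set0 then 1%N else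
    (\sum_(B : {set I} | ~~ (B \subset S) && (B :&: T == A)) H B)%N].
Proof.
rewrite /is_hypergraph ffunE eqxx; apply/forallP => A; rewrite ffunE.
case: eqP => [->|_]; first by rewrite sub0set.
apply/implyP; case: (boolP (A \subset T)) => // nAT.
rewrite big_pred0 // => B; apply/negP => /andP[_ /eqP eA].
by move: nAT; rewrite -eA subsetIr.
Qed.

Definition contraction S T (H : hypergraph (S :|: T)) : hypergraph T :=
  Hypergraph (contraction_subproof H).

Definition seq_union (s : seq {set I}) : {set I} := foldr (@setU I) set0 s.

(* Basis of HG[S_1] (x) ... (x) HG[S_k] for s = [:: S_1; ...; S_k]. *)
Fixpoint hypergraphs (s : seq {set I}) : choiceType :=
  if s is S1 :: s' then (hypergraph S1 * hypergraphs s')%type else unit.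

(* The recursions bottom out at the unit and counit, at the empty sequence. *)
Fixpoint iter_union (s : seq {set I}) :
    hypergraphs s -> hypergraph (seq_union s) :=
  match s with
  | [::] => fun=> empty_hypergraph (set0 : {set I})
  | S1 :: s' => fun p => disjoint_union p.1 (iter_union p.2)
  end.

Fixpoint iter_minors (s : seq {set I}) :
    hypergraph (seq_union s) -> hypergraphs s :=
  match s with
  | [::] => fun=> tt
  | S1 :: s' => fun H => (restriction H, iter_minors (contraction H))
  end.

Definition is_composition S (s : seq {set I}) : bool :=
  [&& set0 \notin s, pairwise (fun A B => [disjoint A & B]) s
    & seq_union s == S].

Definition composition S (k : nat) :=
  {s : k.-tuple {set I} | is_composition S s}.

Lemma composition_union S k (s : composition S k) : seq_union (val s) = S.
Proof. by case: s => s /= /and3P[_ _ /eqP]. Qed.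

Section Components.
Variables (S : {set I}) (G : hypergraph S).

(* Only nonempty multiedges are tested: the empty partition of the empty set  *)
(* has no block to contain the empty multiedge.                               *)
Definition edge_partition (P : {set {set I}}) : bool :=
  partition P S &&
  [forall A : {set I}, (A != set0) && (0 < G A)%N ==>
     [exists B in P, A \subset B]].

Definition refines (P Q : {set {set I}}) : bool :=
  [forall B in P, exists C in Q, B \subset C].

Definition is_finest_edge_partition (P : {set {set I}}) : bool :=
  edge_partition P && [forall Q, edge_partition Q ==> refines P Q].

Definition components : {set {set I}} :=
  odflt set0 [pick P | is_finest_edge_partition P].

Lemma componentsP : is_finest_edge_partition components.
Proof.
rewrite /components; case: pickP => //= noP; exfalso.
pose f x := [ffun P : {set {set I}} =>
  if edge_partition P then pblock P x else set0].
pose P0 := preim_partition f S.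
have partP0 : partition P0 S := preim_partitionP f S.
have [/eqP covP0 tiP0 nP0] := and3P partP0.
have inP0 : {in S &, forall x y, (y \in pblock P0 x) = (f x == f y)}.
  move=> x y xS yS; rewrite pblock_equivalence_partition //.
  by split=> // /eqP ->.
have /negbT := noP P0; rewrite /is_finest_edge_partition.
have -> : edge_partition P0.
  rewrite /edge_partition partP0; apply/forallP => A.
  apply/implyP => /andP[/set0Pn[x xA] GA].
  have AS : A \subset S.
    by case: G GA => m /= /andP[_ /forallP/(_ A)/implyP].
  have xS := subsetP AS x xA.
  apply/existsP; exists (pblock P0 x); rewrite pblock_mem ?covP0 //=.
  apply/subsetP => y yA; rewrite inP0 ?(subsetP AS y yA) //.
  apply/eqP/ffunP => P; rewrite !ffunE; case: ifP => // /andP[pP /forallP eP].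
  have /existsP[B /andP[BP AB]] : [exists B in P, A \subset B].
    by apply: (implyP (eP A)); rewrite GA andbT; apply/set0Pn; exists x.
  have /and3P[_ tiP _] := pP.
  by rewrite !(def_pblock tiP BP) ?(subsetP AB).
move=> /negP; apply; apply/forallP => Q; apply/implyP => eQ.
have /andP[/and3P[/eqP covQ tiQ _] _] := eQ.
apply/forallP => B; apply/implyP => BP0.
have /set0Pn[x xB] : B != set0 by apply: contraNneq nP0 => <-.
have BS : B \subset S by rewrite -covP0; apply: bigcup_sup BP0.
have xS := subsetP BS x xB.
apply/existsP; exists (pblock Q x); rewrite pblock_mem ?covQ //=.
apply/subsetP => y yB; have yS := subsetP BS y yB.
have : y \in pblock P0 x by rewrite (def_pblock tiP0 BP0 xB).
rewrite inP0 // => /eqP/ffunP/(_ Q); rewrite !ffunE eQ => ->.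
by rewrite mem_pblock covQ.
Qed.

End Components.

End Hypergraphs.

Section Antipode.
Variables (K : fieldType) (I : finType).
Implicit Types S : {set I}.

Definition HG S := {freeg (hypergraph S) / K}.

Definition HG_basis S (G : hypergraph S) : HG S := << G >>.

Definition HG_cast S S' (e : S = S') : HG S -> HG S' :=
  fun x => ecast X (HG X) e x.

Definition HG_mu (s : seq {set I}) :
    {freeg (hypergraphs s) / K} -> HG (seq_union s) :=
  fglift (fun p => HG_basis (iter_union p)).

Definition HG_Delta (s : seq {set I}) :
    HG (seq_union s) -> {freeg (hypergraphs s) / K} :=
  fglift (fun H => << iter_minors H >>).

(* A composition of S has at most #|S| parts. *)
Definition antipode S (x : HG S) : HG S :=
  if S == set0 then x else
  \sum_(1 <= k < #|S|.+1) \sum_(s : composition S k)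
    (-1) ^+ k *: HG_cast (composition_union s)
      (HG_mu (HG_Delta (HG_cast (esym (composition_union s)) x))).

End Antipode.

Arguments HG_basis K {I S} G.

(* Only loaded here: its set0 and setT shadow those of finset. *)
From mathcomp Require Import boolp classical_sets functions cardinality fsbigop.
From mathcomp Require Import reals convex.

Local Open Scope classical_set_scope.

Section Polytopes.
Variables (R : realType) (I : finType).
Local Notation RI := {ffun I -> R^o}.

Definition convex_hull (A : set RI) : set RI := smallest (@convex_set R RI) A.

Definition minkowski_sum (A B : set RI) : set RI :=
  [set x + y | x in A & y in B].

Definition basis_vector (i : I) : RI := [ffun j => (i == j)%:R].

Definition simplex (A : {set I}) : set RI :=
  convex_hull [set basis_vector i | i in [set` A]].

Definition polytope (G : hypergraph [set: I]%SET) : set RI :=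
  \big[minkowski_sum/[set 0]]_(A : {set I} | A != finset.set0)
    iter (G A) (minkowski_sum (simplex A)) [set 0].

Definition is_face (P F : set RI) : Prop :=
  exists y : {linear RI -> R^o},
    F = [set x | P x /\ forall z, P z -> y z <= y x].

Definition nonempty_faces (P : set RI) : set (set RI) :=
  [set F | is_face P F /\ F !=set0].

(* The unique hypergraph G with polytope G = F when there is one. *)
Definition hypergraph_of (F : set RI) : hypergraph [set: I]%SET :=
  xget (empty_hypergraph _) [set G | polytope G = F].

End Polytopes.

Arguments polytope R {I} G.

(* Expressions sum_(a in D) c a * x a in basis elements x a. The coefficients *)
(* are integers, so that their signs make sense.                              *)
Section Expressions.
Variables (J X : Type) (D : set J) (c : J -> int) (x : J -> X).

Definition cancellation_free : Prop :=
  forall a b, D a -> D b -> a <> b -> x a = x b -> ~ (c a * c b < 0).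

Definition grouping_free : Prop :=
  forall a b, D a -> D b -> a <> b -> x a <> x b.

End Expressions.

(* Main.v *)
Require Import Defs.
From HB Require Import structures.
From mathcomp Require Import all_boot all_order all_algebra ring.
From mathcomp.multinomials Require Import freeg.

Import Order.TTheory GRing.Theory Num.Theory.

Local Open Scope ring_scope.

(** A set composition s = (S_1, ..., S_k) of I turns H into one hypergraph:
restricting to S_1, contracting, restricting to S_2, ... and then taking the
union of the pieces keeps, of every multiedge A, the part of A in the last
block that A meets.  In terms of the rank of a point (the index of its block),
A is replaced by the set of its points of largest rank.  Call the result the
leading hypergraph of H for s ([leading], [iter_union_minors]); the antipode
of H is therefore the sum of (-1)^k times the leading hypergraph over all set
compositions ([antipodeE]).

The leading hypergraphs are exactly those of the faces.  A linear functional y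
is maximal on a Minkowski sum where it is maximal on every summand, and the
face of a simplex on A is the simplex on the points of A where y is largest.
So the face of the polytope of H in the direction y is the polytope of the
leading hypergraph for the composition that sorts I by the values of y
([face_polytope], [exists_rank]), and every composition arises in this way.
As a hypergraph is determined by its polytope ([polytope_inj]), faces and
leading hypergraphs correspond one to one ([facesE]).

There remains the coefficient of a leading hypergraph G, namely the sum of
(-1)^k over the compositions that lead to G.  If two compositions lead to the
same G, then they already select the same part of each single multiedge of H
([leading_sub]).  Hence leading to G amounts to conditions on the ranks of
pairs of points: the rank is constant on each selected part, that is, on the
connected components of G, and it is smaller on the rest of a multiedge than
on its selected part ([leading_adapted]).  Geometrically these compositions
are the cells of the braid arrangement that make up the relatively open normal
cone of the face, which has dimension c(G), and the sum is its Euler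
characteristic.  Combinatorially, one counts the strictly monotone surjections
from an acyclic relation on the components onto chains.  The first block of
such a surjection is an arbitrary nonempty set of minimal elements, and as
the signed number of nonempty subsets of a nonempty set is -1, removing the
first block proves by induction that the sum is (-1)^c(G) ([sum_adapted]). *)

(** * Ordered set compositions *)

Section Compositions.
Set Implicit Arguments.
Unset Strict Implicit.
Variable I : finType.
Implicit Types (S T A B : {set I}) (s t : seq {set I}).

(** The bound n on the number of blocks makes the recursion structural; the
compositions of S are all enumerated as soon as n is at least #|S|. *)
Fixpoint compositions n S : seq (seq {set I}) :=
  if S == set0 then [:: [::]] else
  if n is n'.+1 then
    [seq A :: s | A <- enum [pred A in powerset S | A != set0],
                  s <- compositions n' (S :\: A)]
  else [::].

Lemma disjoint_seq_union A s :
  all (fun B => [disjoint A & B]) s = [disjoint A & seq_union s].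
Proof.
elim: s => [|B s IHs] /=; first by rewrite disjoint_sym disjoints_subset sub0set.
by rewrite IHs -!setI_eq0 setIUr setU_eq0.
Qed.

Lemma is_composition_cons S A s :
  is_composition S (A :: s) =
    [&& A != set0, A \subset S & is_composition (S :\: A) s].
Proof.
rewrite /is_composition /= inE negb_or eq_sym disjoint_seq_union -!andbA.
case: (A != set0) => //=; case: (set0 \notin s) => /=; last by rewrite andbF.
case: (pairwise _ s) => /=; last by rewrite !andbF.
apply/andP/andP => -[].
  move=> dAs /eqP <-; rewrite subsetUl setDUl setDv set0U; split=> //.
  by apply/eqP/esym/setDidPl; rewrite disjoint_sym.
move=> AS /eqP->; split; last by rewrite -{1}(setIidPr AS) setID.
by rewrite -setI_eq0 setIDA setDIl setDv set0I.
Qed.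

Lemma is_composition_nil S : is_composition S [::] = (S == set0).
Proof. by rewrite /is_composition /= eq_sym. Qed.

Lemma is_composition_set0 s : is_composition set0 s = (s == [::]).
Proof.
case: s => [|A s]; first by rewrite is_composition_nil eqxx.
by rewrite is_composition_cons subset0; case: (A == set0).
Qed.

Lemma leq_card_setD n S A :
  A \subset S -> A != set0 -> (#|S| <= n.+1)%N -> (#|S :\: A| <= n)%N.
Proof.
move=> AS; rewrite -card_gt0 => A0 leS.
by rewrite cardsD (setIidPr AS) -ltnS (leq_trans _ leS) // ltn_subrL A0
  (leq_trans A0) ?subset_leq_card.
Qed.

Lemma mem_compositions n S s :
  (#|S| <= n)%N -> (s \in compositions n S) = is_composition S s.
Proof.
elim: n S s => [|n IHn] S s leS /=.
  move: leS; rewrite leqn0 cards_eq0 => /eqP->.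
  by rewrite eqxx inE is_composition_set0.
case: eqP => [->|/eqP nS0]; first by rewrite inE is_composition_set0.
apply/allpairsPdep/idP => [[A [t [PA tP ->]]]|].
  move: PA; rewrite mem_enum !inE => /andP[AS A0].
  by rewrite is_composition_cons A0 AS -IHn // leq_card_setD.
case: s => [|A s]; first by rewrite is_composition_nil (negbTE nS0).
rewrite is_composition_cons => /and3P[A0 AS cs]; exists A, s; split=> //.
  by rewrite mem_enum !inE AS.
by rewrite IHn ?leq_card_setD.
Qed.

Lemma compositions_uniq n S : uniq (compositions n S).
Proof.
elim: n S => [|n IHn] S /=; case: ifP => // _.
apply: allpairs_uniq_dep => [|A _|]; [exact: enum_uniq | exact: IHn |].
by move=> [A s] [B t] /= _ _ [<- <-].
Qed.

Lemma big_compositions (V : nmodType) n S (P : pred (seq {set I}))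
    (F : seq {set I} -> V) : S != set0 ->
  \sum_(s <- compositions n.+1 S | P s) F s =
  \sum_(A : {set I} | (A \subset S) && (A != set0))
    \sum_(s <- compositions n (S :\: A) | P (A :: s)) F (A :: s).
Proof.
move=> nS0; rewrite /= (negbTE nS0) big_mkcond big_allpairs_dep big_enum /=.
apply: eq_big => [A|A _]; first by rewrite !inE.
by rewrite [RHS]big_mkcond.
Qed.

(** A point in no block has rank size s, above the index of every block. *)
Definition rank s x := find (fun A : {set I} => x \in A) s.

Lemma rank_cons A s x : rank (A :: s) x = if x \in A then 0%N else (rank s x).+1.
Proof. by []. Qed.

Definition rank_le s : rel I := relpre (rank s) leq.

Lemma rank_leE s x y : rank_le s x y = (rank s x <= rank s y)%N.
Proof. by []. Qed.

Lemma size_composition S s : is_composition S s -> (size s <= #|S|)%N.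
Proof.
elim: s S => //= A s IHs S; rewrite is_composition_cons.
case/and3P; rewrite -card_gt0 => A0 AS /IHs.
rewrite cardsD (setIidPr AS) => les; apply: leq_ltn_trans les _.
by rewrite ltn_subrL A0 (leq_trans A0) ?subset_leq_card.
Qed.

(** Each composition of a nonempty S has between 1 and #|S| blocks. *)
Lemma sum_composition (V : nmodType) S (F : seq {set I} -> V) : S != set0 ->
  \sum_(1 <= k < #|S|.+1) \sum_(s : composition S k) F (val (val s)) =
  \sum_(s <- compositions #|S| S) F s.
Proof.
move=> nS0; transitivity (\sum_(s <- compositions #|S| S)
    \sum_(1 <= k < #|S|.+1 | size s == k) F s); last first.
  apply: eq_big_seq => s; rewrite mem_compositions // => cs.
  have s_gt0 : (0 < size s)%N.
    by case: s cs => //; rewrite is_composition_nil (negbTE nS0).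
  (* The size of s lies in the range of k, so that exactly one term counts s. *)
  rewrite (big_rem (size s)) ?mem_index_iota ?s_gt0 ?ltnS ?size_composition //=.
  rewrite eqxx big_seq_cond big1 ?addr0 // => k /andP[].
  by rewrite mem_rem_uniq ?iota_uniq // inE eq_sym => /andP[/negbTE-> _].
under [RHS]eq_bigr do rewrite big_mkcond.
rewrite exchange_big; apply: eq_bigr => k _; rewrite -big_mkcond -big_filter.
rewrite -(big_map (fun s : composition S k => val (val s)) xpredT F) /=.
apply/perm_big/uniq_perm.
- by rewrite map_inj_uniq ?index_enum_uniq // => s t /val_inj/val_inj.
- by rewrite filter_uniq ?compositions_uniq.
move=> s; rewrite mem_filter mem_compositions //; apply/mapP/andP.
  by case=> -[t ct] _ /= ->; rewrite size_tuple.
case=> /eqP <- cs; pose isC := fun t : (size s).-tuple {set I} => is_composition S t.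
exists (exist isC (in_tuple s) cs) => //.
by rewrite mem_index_enum.
Qed.

End Compositions.

Section Sorting.
Set Implicit Arguments.
Unset Strict Implicit.
Variables (I : finType) (d : Order.disp_t) (X : orderType d).

(** Sorting by h: the block of smallest values comes first. *)
Lemma exists_rank (h : I -> X) (S : {set I}) : exists2 s,
  is_composition S s & {in S &, forall x y, rank_le s x y = (h x <= h y)%O}.
Proof.
have [n] := ubnP #|S|; elim: n S => // n IHn S leS.
have [->|/set0Pn[x0 x0S]] := eqVneq S set0.
  by exists [::]; [rewrite is_composition_nil | move=> x y; rewrite inE].
pose B := [set x in S | [forall y in S, h x <= h y]%O].
have BP x : reflect (x \in S /\ {in S, forall y, h x <= h y}%O) (x \in B).
  by rewrite inE; apply: (iffP andP) => -[xS /forall_inP].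
have BS : B \subset S by apply/subsetP => x /BP[].
have B0 : B != set0.
  case: (Order.TotalTheory.arg_minP h x0S) => x xS minx.
  by apply/set0Pn; exists x; apply/BP.
have ltS : (#|S :\: B| < n)%N.
  rewrite ltnS in leS; apply: leq_trans leS; apply/proper_card/properP.
  split; first exact: subsetDl.
  by have /set0Pn[b bB] := B0; exists b; rewrite ?(subsetP BS) // in_setD bB.
have [s cs rs] := IHn _ ltS.
exists (B :: s); first by rewrite is_composition_cons B0 BS.
move=> x y xS yS; rewrite rank_leE !rank_cons.
have [/BP[_ /(_ y yS)->//]|nxB] := boolP (x \in B).
have [/BP[_ miny]|nyB] := boolP (y \in B); last first.
  by rewrite ltnS -rank_leE rs ?in_setD ?nxB ?nyB.
apply/esym/negbTE; apply: contraNN nxB => lexy; apply/BP; split=> // z zS.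
exact: le_trans lexy (miny z zS).
Qed.
End Sorting.

(** * Signed count of the compositions adapted to an acyclic relation *)

Section Count.
Set Implicit Arguments.
Unset Strict Implicit.

(** Adding or removing a fixed m of M reverses the sign of a subset. *)
Lemma sum_sign_subset (J : finType) (M : {set J}) : M != set0 ->
  \sum_(Q : {set J} | Q \subset M) (-1) ^+ #|Q| = 0 :> int.
Proof.
case/set0Pn=> m mM; pose toggle (Q : {set J}) := if m \in Q then Q :\ m else m |: Q.
have toggleK : involutive toggle.
  move=> Q; rewrite /toggle; case: (boolP (m \in Q)) => mQ.
    by rewrite setD11 setD1K.
  by rewrite setU11 setU1K.
set X := LHS; suff: X = - X by move/eqP; rewrite -addr_eq0 -mulr2n mulrn_eq0 => /eqP.
rewrite {1}/X (reindex_inj (inv_inj toggleK)) -sumrN; apply: eq_big => Q.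
  rewrite /toggle; case: ifP => mQ; last by rewrite subUset sub1set mM.
  by rewrite subDset (setUidPr _) // sub1set.
move=> _; rewrite /toggle; case: ifP => mQ.
  by rewrite (cardsD1 m Q) mQ exprS mulN1r opprK.
by rewrite cardsU1 mQ exprS mulN1r.
Qed.

Variables (I J : finType) (c : I -> J) (r : rel I).
Implicit Types (S A B : {set I}) (s : seq {set I}) (P Q M : {set J}).

(** The map c identifies the points that have to share a block, and r x y
asks for x to lie in an earlier block than y. *)
Definition adapted S s := [forall x in S, forall y in S,
  ((c x == c y) ==> (rank s x == rank s y)) &&
  (r x y ==> (rank s x < rank s y)%N)].

Lemma adaptedP S s : reflect
  {in S &, forall x y, (c x = c y -> rank s x = rank s y) /\
                       (r x y -> (rank s x < rank s y)%N)} (adapted S s).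
Proof.
apply: (iffP 'forall_in_forall_inP) => h x; last first.
  move=> xS y yS; case: (h x y xS yS) => h1 h2; apply/andP.
  by split; apply/implyP => // /eqP/h1->.
move=> y xS yS; case/andP: (h x xS y yS) => /implyP h1 /implyP h2.
by split=> // /eqP/h1/eqP.
Qed.

(** The conditions that an adapted composition imposes on its first block
alone; see [adapted_cons]. *)
Definition initial S A := [forall x in S, forall y in S,
  ((c x == c y) ==> ((x \in A) == (y \in A))) && (r x y ==> (y \notin A))].

Lemma initialP S A : reflect
  {in S &, forall x y, (c x = c y -> (x \in A) = (y \in A)) /\
                       (r x y -> y \notin A)} (initial S A).
Proof.
apply: (iffP 'forall_in_forall_inP) => h x; last first.
  move=> xS y yS; case: (h x y xS yS) => h1 h2; apply/andP.
  by split; apply/implyP => // /eqP/h1->.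
move=> y xS yS; case/andP: (h x xS y yS) => /implyP h1 /implyP h2.
by split=> // /eqP/h1/eqP.
Qed.

Lemma adapted_cons S A s :
  adapted S (A :: s) = initial S A && adapted (S :\: A) s.
Proof.
apply/adaptedP/andP => [h|[/initialP hA /adaptedP hs]].
  split; [apply/initialP|apply/adaptedP] => x y.
    move=> xS yS; case: (h x y xS yS); rewrite !rank_cons.
    by case: (x \in A) (y \in A) => [] [] h1 h2; split=> // /h1 || move=> /h2.
  rewrite !inE => /andP[/negbTE xA xS] /andP[/negbTE yA yS].
  case: (h x y xS yS); rewrite !rank_cons xA yA ltnS => h1 h2; split=> //.
  by move=> /h1[].
move=> x y xS yS; case: (hA x y xS yS) => h1 h2; rewrite !rank_cons.
split.
  move=> cxy; move: (hs x y) (h1 cxy); rewrite !inE xS yS !andbT => h <-.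
  by case: (boolP (x \in A)) (h1 cxy) h => //= xA <- h; case: h => // -> .
move=> rxy; move: (h2 rxy) => yA; rewrite (negbTE yA); case: ifP => // /negbT xA.
by rewrite ltnS; case: (hs x y) => [||_]; rewrite ?inE ?xA ?yA //; apply.
Qed.

Variable f : I -> nat.
Hypothesis fc : forall x y, c x = c y -> f x = f y.
Hypothesis fr : forall x y, r x y -> (f x < f y)%N.

Definition minimal P := [set j in P | [forall x, forall y,
   [&& c x \in P, c y == j & r x y] ==> false]].

Lemma minimalP P j : reflect
  (j \in P /\ forall x y, c x \in P -> c y = j -> ~~ r x y) (j \in minimal P).
Proof.
rewrite inE; apply: (iffP andP) => -[jP h]; split=> //.
  move=> x y xP cy; apply/negP => rxy.
  by move/forallP/(_ x)/forallP/(_ y): h; rewrite xP cy eqxx rxy.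
apply/forallP => x; apply/forallP => y; apply/implyP => /and3P[xP /eqP cy].
by move=> rxy; case/negP: (h x y xP cy).
Qed.

(** A point with the smallest value of f among those over P has no
predecessor, as f increases along r. *)
Lemma minimal_neq0 P : P \subset c @: setT -> P != set0 -> minimal P != set0.
Proof.
move=> Pc /set0Pn[j jP]; have /imsetP[x0 _ jx] := subsetP Pc j jP; subst j.
case: (arg_minnP f (P := fun x => c x \in P) jP) => x xP minx.
apply/set0Pn; exists (c x); apply/minimalP; split=> // y z yP cz.
apply: contraL (minx y yP) => ryz.
by rewrite -ltnNge -(fc cz) fr.
Qed.

(** No first block contains a point that has a predecessor, and conversely
any set of classes without predecessors can come first. *)
Lemma initial_preim P Q : P \subset c @: setT -> Q \subset P ->
  initial (c @^-1: P) (c @^-1: Q) = (Q \subset minimal P).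
Proof.
move=> Pc QP; apply/initialP/subsetP => [h j jQ|h x y].
  have jP := subsetP QP j jQ; apply/minimalP; split=> // x y xP cy.
  apply/negP => rxy; case: (h x y); rewrite ?inE ?cy // => _ /(_ rxy).
  by rewrite jQ.
rewrite !inE => xP yP; split=> [-> //|rxy]; apply/negP => /h/minimalP[_ nr].
by move: (nr x y xP erefl); rewrite rxy.
Qed.

(** The sum depends only on the number of classes.  Removing the first block,
the preimage of a nonempty set Q of minimal classes, leaves by induction the
sign of #|P| - #|Q|, and the signs of all such Q add up to -1.  The function
f, which is constant on classes and increases along r, says that r induces
an acyclic relation between the classes. *)
Lemma sum_adapted n P : P \subset c @: setT -> (#|c @^-1: P| <= n)%N ->
  \sum_(s <- compositions n (c @^-1: P) | adapted (c @^-1: P) s)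
    (-1) ^+ size s = (-1) ^+ #|P| :> int.
Proof.
elim: n P => [|n IHn] P Pc lePn; have [P0|P0] := eqVneq P set0.
- rewrite P0 preimset0 /= eqxx big_cons big_nil cards0 /= addr0 ifT //.
  by apply/adaptedP => x y; rewrite inE.
- case/set0Pn: P0 => j jP; have /imsetP[x _ jx] := subsetP Pc j jP.
  move: lePn; rewrite leqn0 cards_eq0 => /eqP/setP/(_ x).
  by rewrite !inE -jx jP.
- rewrite P0 preimset0 /= eqxx big_cons big_nil cards0 /= addr0 ifT //.
  by apply/adaptedP => x y; rewrite inE.
have S0 : c @^-1: P != set0.
  case/set0Pn: P0 => j jP; have /imsetP[x _ jx] := subsetP Pc j jP.
  by apply/set0Pn; exists x; rewrite inE -jx.
rewrite big_compositions //.
pose sgn Q : int := (-1) ^+ #|Q|.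
transitivity (\sum_(Q : {set J} | (Q \subset minimal P) && (Q != set0))
  - (sgn P * sgn Q)).
  transitivity (\sum_(A : {set I} | [&& A \subset c @^-1: P, A != set0
       & initial (c @^-1: P) A])
      \sum_(s <- compositions n (c @^-1: P :\: A) | adapted (c @^-1: P :\: A) s)
       - (-1) ^+ size s : int).
    under [RHS]eq_bigl do rewrite andbA.
    rewrite [RHS]big_mkcondr; apply: eq_bigr => A _.
    under eq_bigl do rewrite adapted_cons.
    case: ifP => _; last by rewrite big_pred0.
    by apply: eq_bigr => s _; rewrite /= exprS mulN1r.
  have imK Q : Q \subset P -> c @: (c @^-1: Q) = Q.
    move=> QP; apply/setP => j; apply/imsetP/idP => [[x]|jQ].
      by rewrite inE => xQ ->.
    have /imsetP[x _ jx] := subsetP Pc j (subsetP QP j jQ).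
    by exists x; rewrite // inE -jx.
  (* An initial block is a union of classes, hence a preimage under c. *)
  rewrite (reindex_onto (fun Q => c @^-1: Q) (fun A => c @: A)) /=; last first.
    move=> A /and3P[AP _ /initialP iA]; apply/setP => x; rewrite inE.
    apply/imsetP/idP => [[y yA cxy]|xA]; last by exists x.
    have yP : y \in c @^-1: P := subsetP AP y yA.
    have xP : x \in c @^-1: P by move: yP; rewrite !inE cxy.
    by case: (iA x y xP yP) => ->.
  apply: eq_big => [Q|Q].
    apply/idP/idP => [/andP[/and3P[QP Q0 iQ] /eqP eQ]|/andP[QM Q0]].
      have QP' : Q \subset P.
        apply/subsetP => j; rewrite -eQ => /imsetP[x xQ ->].
        by move: (subsetP QP x xQ); rewrite inE.
      rewrite -initial_preim // iQ; apply: contraNneq Q0 => ->.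
      by rewrite preimset0.
    have QP : Q \subset P.
      by apply: subset_trans QM _; apply/subsetP => j /minimalP[].
    rewrite initial_preim // QM preimsetS // imK // eqxx !andbT /=.
    by apply: contraNneq Q0 => Q0; rewrite -(imK Q) // Q0 imset0.
  case/andP=> /and3P[QP Q0 iQ] /eqP eQ; rewrite sumrN.
  have QP' : Q \subset P.
    apply/subsetP => j; rewrite -eQ => /imsetP[x xQ ->].
    by move: (subsetP QP x xQ); rewrite inE.
  rewrite -preimsetD IHn.
  - by rewrite /sgn cardsD (setIidPr QP') -signr_odd oddB ?subset_leq_card //
      signr_addb !signr_odd.
  - exact: subset_trans (subsetDl _ _) Pc.
  - by rewrite preimsetD leq_card_setD.
rewrite sumrN -mulr_sumr -mulrN.
have := sum_sign_subset (minimal_neq0 Pc P0).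
rewrite (bigD1 set0) ?sub0set //= cards0 => /eqP.
by rewrite addrC addr_eq0 => /eqP->; rewrite opprK mulr1.
Qed.

End Count.

(** * Leading hypergraphs and iterated minors *)

Section Leading.
Set Implicit Arguments.
Unset Strict Implicit.
Variable I : finType.
Implicit Types (S T A B C U : {set I}) (s t : seq {set I}) (f g : I -> nat).

Lemma mult_set0 S (H : hypergraph S) : H set0 = 1%N.
Proof. by case: H => m /= /andP[/eqP]. Qed.

Lemma mult_sub S (H : hypergraph S) A : (0 < H A)%N -> A \subset S.
Proof. by case: H => m /= /andP[_ /forallP/(_ A)/implyP]. Qed.

Lemma eq_hypergraph S (G H : hypergraph S) :
  (forall A, A != set0 -> G A = H A) -> G = H.
Proof.
move=> GH; apply/val_inj/ffunP => A /=.
by have [->|/GH//] := eqVneq A set0; rewrite !mult_set0.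
Qed.

(** For a total preorder le, the points of A that are largest.  Only the order
matters, so that ranks in a composition and values of a real functional are
treated alike. *)
Definition top_part (le : rel I) A := [set x in A | [forall y in A, le y x]].

Lemma top_partP (le : rel I) A x :
  reflect (x \in A /\ {in A, forall y, le y x}) (x \in top_part le A).
Proof. by rewrite inE; apply: (iffP andP) => -[xA /forall_inP]. Qed.

Lemma top_part_sub (le : rel I) A : top_part le A \subset A.
Proof. by apply/subsetP => x /top_partP[]. Qed.

Lemma top_part0 (le : rel I) : top_part le set0 = set0.
Proof. by apply/eqP; rewrite -subset0 top_part_sub. Qed.

Lemma top_part_eq0 f A : (top_part (relpre f leq) A == set0) = (A == set0).
Proof.
have [->|/set0Pn[x0 x0A]] := eqVneq A set0; first by rewrite top_part0 eqxx.
apply/negbTE/set0Pn; case: (arg_maxnP f x0A) => x xA maxx.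
by exists x; apply/top_partP.
Qed.

Fact leading_subproof S (le : rel I) (H : hypergraph S) :
  is_hypergraph S [ffun K : {set I} => if K == set0 then 1%N else
    (\sum_(A : {set I} | top_part le A == K) H A)%N].
Proof.
rewrite /is_hypergraph ffunE eqxx; apply/forallP => K; rewrite ffunE.
case: eqP => [->|_]; first by rewrite sub0set.
apply/implyP; rewrite lt0n sum_nat_eq0 => /forall_inPn[A /eqP <-].
by rewrite -lt0n => /mult_sub; apply/subset_trans/top_part_sub.
Qed.

Definition leading S (le : rel I) (H : hypergraph S) : hypergraph S :=
  Hypergraph (leading_subproof le H).

Lemma leadingE S (le : rel I) (H : hypergraph S) K : K != set0 ->
  leading le H K = (\sum_(A : {set I} | top_part le A == K) H A)%N.
Proof. by move=> /negbTE nK; rewrite /leading /= ffunE nK. Qed.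

Lemma disjoint_unionE S T (G : hypergraph S) (H : hypergraph T) K : K != set0 ->
  disjoint_union G H K = (G K + H K)%N.
Proof. by move=> /negbTE nK; rewrite /= ffunE nK. Qed.

Lemma restrictionE S T (H : hypergraph (S :|: T)) K :
  restriction H K = if K \subset S then H K else 0%N.
Proof. by rewrite /= ffunE. Qed.

Lemma contractionE S T (H : hypergraph (S :|: T)) K : K != set0 ->
  contraction H K =
    (\sum_(B : {set I} | ~~ (B \subset S) && (B :&: T == K)) H B)%N.
Proof. by move=> /negbTE nK; rewrite /= ffunE nK. Qed.

Lemma leading_gt0 S (le : rel I) (H : hypergraph S) A :
  (0 < H A)%N -> (0 < leading le H (top_part le A))%N.
Proof.
move=> HA; have [->|nz] := eqVneq (top_part le A) set0; first by rewrite mult_set0.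
by rewrite leadingE // (bigD1 A) //= ltn_addr.
Qed.

Lemma leading_gt0P S (le : rel I) (H : hypergraph S) K : K != set0 ->
  reflect (exists2 A, (0 < H A)%N & top_part le A = K) (0 < leading le H K)%N.
Proof.
move=> K0; apply: (iffP idP) => [|[A HA <-]]; last exact: leading_gt0.
rewrite leadingE // lt0n sum_nat_eq0 => /forall_inPn[A /eqP <-].
by rewrite -lt0n; exists A.
Qed.

(** The recursion of iterated minors: an edge inside the first block is kept
by the restriction, any other edge loses that block in the contraction. *)
Lemma top_part_rank_cons A s C : top_part (rank_le (A :: s)) C =
  if C \subset A then C else top_part (rank_le s) (C :\: A).
Proof.
case: ifP => [CA|/negbT/subsetPn[z zC zA]]; apply/setP => x.
  apply/top_partP/idP => [[]//|xC]; split=> // y yC.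
  by rewrite rank_leE !rank_cons !(subsetP CA).
apply/top_partP/top_partP => [[xC h]|].
  have := h z zC; rewrite rank_leE !rank_cons (negbTE zA).
  case: ifP => // xA _; split; first by rewrite inE xA.
  move=> y; rewrite inE => /andP[/negbTE yA /h].
  by rewrite rank_leE !rank_cons xA yA ltnS.
rewrite inE => -[/andP[xA xC] h]; split=> // y yC.
rewrite rank_leE !rank_cons (negbTE xA); case: ifP => // /negbT yA.
by rewrite ltnS; apply: h; rewrite inE yA.
Qed.

(** By induction on the blocks: an edge that is not inside the first block
survives as its trace on the other blocks, where the induction cuts it. *)
Lemma iter_union_minors s (H : hypergraph (seq_union s)) :
  pairwise (fun A B => [disjoint A & B]) s ->
  iter_union (iter_minors H) = leading (rank_le s) H.
Proof.
elim: s H => [|A s IHs] /= H.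
  move=> _; apply: eq_hypergraph => K K0.
  rewrite leadingE //= ffunE (negbTE K0) big1 // => C /eqP eK.
  apply/eqP; rewrite -leqn0 leqNgt; apply: contraNN K0 => /mult_sub.
  by rewrite subset0 -eK => /eqP->; rewrite top_part0.
rewrite disjoint_seq_union => /andP[dA ps]; rewrite IHs //.
apply: eq_hypergraph => K K0; rewrite disjoint_unionE // !leadingE //.
rewrite restrictionE [RHS](bigID (fun C => C \subset A)) /=; congr (_ + _)%N.
  rewrite (eq_bigl (fun C => (C \subset A) && (C == K))); last first.
    by move=> C; rewrite top_part_rank_cons andbC; case: (C \subset A).
  by rewrite big_mkcondl big_pred1_eq.
rewrite [RHS](eq_bigl (fun C => ~~ (C \subset A) &&
    (top_part (rank_le s) (C :\: A) == K))); last first.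
  by move=> C; rewrite top_part_rank_cons andbC; case: (C \subset A).
(* Multiplicities in a contraction add up over the edges with a given trace. *)
rewrite [RHS](partition_big (fun C => C :\: A)
    (fun B => top_part (rank_le s) B == K)) /=; last by move=> C /andP[].
apply: eq_bigr => B /eqP eK; rewrite contractionE; last first.
  by apply: contraNneq K0 => B0; rewrite -eK B0 top_part0.
under [RHS]eq_bigl => C.
  rewrite -andbA; have -> : (top_part (rank_le s) (C :\: A) == K) &&
      (C :\: A == B) = (C :\: A == B).
    by case: (C :\: A =P B) => [->|]; rewrite ?andbF // eK eqxx.
  over.
rewrite [LHS]big_mkcond [RHS]big_mkcond; apply: eq_bigr => C _.
have [->|/mult_sub CS] := posnP (H C); first by rewrite !if_same.
congr (if _ && (_ == _) then _ else _); rewrite setDE.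
apply/setP => x; rewrite !inE; apply/andP/andP => -[xC].
  by move=> xs; rewrite (contraTN _ xs) // => xA; rewrite (disjointFr dA).
by move=> xA; have := subsetP CS x xC; rewrite inE (negbTE xA).
Qed.

(** A leading hypergraph determines how each single edge was cut.  Fix an edge
A, and let U be the set of points at which g is at least the maximum of g on
A.  The edges B with largest part inside U have the same total multiplicity
for f and for g, since the leading hypergraphs agree.  If the part of B for f
lies in U, then B meets U, so that the part for g lies in U too; equality of
the totals thus forces the converse for each edge that occurs.  It applies to
A, and a point of A inside U is largest for g. *)
Lemma leading_sub S f g (H : hypergraph S) :
  leading (relpre f leq) H = leading (relpre g leq) H ->
  forall A, (0 < H A)%N ->
    top_part (relpre f leq) A \subset top_part (relpre g leq) A.
Proof.
move=> eH A HA; apply/subsetP => x xf.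
have [x0 /top_partP[x0A maxx0]] : exists x0, x0 \in top_part (relpre g leq) A.
  apply/set0Pn; rewrite top_part_eq0; apply/set0Pn; exists x.
  by case/top_partP: xf.
pose U := [set y | (g x0 <= g y)%N].
pose above h B := (B != set0) && (top_part (relpre h leq) B \subset U).
have sum_above h : (\sum_(B : {set I} | above h B) H B =
    \sum_(K : {set I} | (K != set0) && (K \subset U))
       leading (relpre h leq) H K)%N.
  rewrite (partition_big (top_part (relpre h leq))
    (fun K => (K != set0) && (K \subset U))) /=; last first.
    by move=> B; rewrite /above top_part_eq0.
  apply: eq_bigr => K /andP[K0 KU]; rewrite leadingE //; apply: eq_bigl => B.
  rewrite /above -(top_part_eq0 h).
  by case: (top_part _ B =P K) => [->|]; rewrite ?andbF // K0 KU.
have fg B : above f B -> above g B.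
  rewrite /above -(top_part_eq0 f) => /andP[/set0Pn[y yf] fU].
  have := subsetP fU y yf; rewrite inE => le0y.
  have yB : y \in B by case/top_partP: yf.
  apply/andP; split; first by apply/set0Pn; exists y.
  apply/subsetP => z /top_partP[_ /(_ y yB)/= leyz].
  by rewrite inE (leq_trans le0y).
have gA : above g A.
  apply/andP; split; first by apply/set0Pn; exists x0.
  by apply/subsetP => z /top_partP[_ /(_ x0 x0A)]; rewrite inE.
have /andP[_ /subsetP/(_ x xf)] : above f A.
  have /eqP := sum_above f; rewrite eH -sum_above (bigID (above f) (above g)) /=.
  under [X in _ == (X + _)%N]eq_bigl => B.
    have -> : above g B && above f B = above f B.
      by case: (boolP (above f B)) => [/fg->|]; rewrite ?andbF.
    over.
  rewrite -{1}[X in X == _]addn0 eqn_add2l eq_sym sum_nat_eq0.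
  move=> /forall_inP/(_ A); rewrite gA /= => h.
  by apply: contraLR HA => /h; rewrite -leqNgt leqn0.
rewrite inE => le0x; apply/top_partP; split; first by case/top_partP: xf.
by move=> y /maxx0/= /leq_trans; apply.
Qed.

Lemma leading_eqP S f g (H : hypergraph S) : reflect
  (forall A, (0 < H A)%N -> top_part (relpre f leq) A = top_part (relpre g leq) A)
  (leading (relpre f leq) H == leading (relpre g leq) H).
Proof.
apply: (iffP eqP) => [e A HA|e].
  by apply/eqP; rewrite eqEsubset !(leading_sub (H := H)).
apply: eq_hypergraph => K K0; rewrite !leadingE //.
rewrite [LHS]big_mkcond [RHS]big_mkcond; apply: eq_bigr => A _.
by have [->|/e->//] := posnP (H A); rewrite !if_same.
Qed.

Section Components.
Variables (S : {set I}) (G : hypergraph S).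

Lemma components_partition : partition (components G) S.
Proof. by case/andP: (componentsP G) => /andP[]. Qed.

Lemma components_edge A x y : (0 < G A)%N -> x \in A -> y \in A ->
  pblock (components G) x = pblock (components G) y.
Proof.
move=> GA xA yA; case/andP: (componentsP G) => /andP[/and3P[_ tiP _] /forallP h _].
have /existsP[B /andP[BP AB]] : [exists B in components G, A \subset B].
  by apply: (implyP (h A)); rewrite GA andbT; apply/set0Pn; exists x.
by rewrite !(def_pblock tiP BP) ?(subsetP AB).
Qed.

(** Components form the finest partition that the edges respect, and the fibres
of h are another one. *)
Lemma components_min (X : eqType) (h : I -> X) :
  (forall A, (0 < G A)%N -> {in A &, forall x y, h x = h y}) ->
  {in S &, forall x y, pblock (components G) x = pblock (components G) y ->
     h x = h y}.
Proof.
move=> hG x y xS yS exy.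
have eqR : {in S & &, equivalence_rel (fun x y => h x == h y)}.
  by move=> u v w _ _ _; split=> // /eqP->.
pose Q := equivalence_partition (fun x y => h x == h y) S.
have partQ : partition Q S := equivalence_partitionP eqR.
have eQ : edge_partition G Q.
  rewrite /edge_partition partQ; apply/forallP => A.
  apply/implyP => /andP[/set0Pn[z zA] GA].
  have AS := subsetP (mult_sub GA); have [/eqP cQ _ _] := and3P partQ.
  apply/existsP; exists (pblock Q z); rewrite pblock_mem ?cQ ?AS //=.
  apply/subsetP => w wA; rewrite pblock_equivalence_partition ?AS //.
  by apply/eqP/(hG A).
case/andP: (componentsP G) => /andP[/and3P[/eqP cP tiP _] _] /forallP/(_ Q).
rewrite eQ /= => /forallP/(_ (pblock (components G) x)).
rewrite pblock_mem ?cP //= => /existsP[C /andP[CQ /subsetP PC]].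
have /and3P[_ tiQ _] := partQ.
have xC : x \in C by apply: PC; rewrite mem_pblock cP.
have yC : y \in C by apply: PC; rewrite exy mem_pblock cP.
have : y \in pblock Q x by rewrite (def_pblock tiQ CQ xC).
by rewrite pblock_equivalence_partition // => /eqP.
Qed.
End Components.

(** The strict inequalities that define the relatively open normal cone of the
face in the direction f. *)
Definition below f S (H : hypergraph S) : rel I := fun y x =>
  [exists A : {set I}, [&& (0 < H A)%N, x \in top_part (relpre f leq) A &
     y \in A :\: top_part (relpre f leq) A]].

Lemma belowP f S (H : hypergraph S) y x : reflect
  (exists A : {set I}, [/\ (0 < H A)%N, x \in top_part (relpre f leq) A,
     y \in A & y \notin top_part (relpre f leq) A]) (below f H y x).
Proof.
apply: (iffP existsP) => -[A].
  by case/and3P => HA xA; rewrite inE => /andP[? ?]; exists A.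
by case=> HA xA yA nyA; exists A; rewrite HA xA inE nyA.
Qed.

Lemma top_part_eq f A x y : x \in top_part (relpre f leq) A ->
  y \in top_part (relpre f leq) A -> f x = f y.
Proof.
move=> /top_partP[xA hx] /top_partP[yA hy].
by apply/anti_leq/andP; split; [exact: hy|exact: hx].
Qed.

Lemma top_part_lt f A x y : x \in top_part (relpre f leq) A ->
  y \in A -> y \notin top_part (relpre f leq) A -> (f y < f x)%N.
Proof.
move=> /top_partP[xA hx] yA; apply: contraNltn => xy.
apply/top_partP; split=> // z zA; exact: leq_trans (hx z zA) xy.
Qed.

(** By [leading_eqP] it is enough to compare the parts selected in each edge.
A part is selected if the rank is constant on it, which over all edges means
constant on components, and smaller on the rest of the edge. *)
Lemma leading_adapted f (H : hypergraph [set: I]) s :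
  (leading (rank_le s) H == leading (relpre f leq) H) =
  adapted (pblock (components (leading (relpre f leq) H))) (below f H) [set: I] s.
Proof.
set G := leading (relpre f leq) H.
apply/leading_eqP/adaptedP => [e x y _ _|h A HA].
  split; last by case/belowP => A [HA]; rewrite -(e A HA); apply: top_part_lt.
  apply: components_min; rewrite ?inE // => K; have [->|K0] := eqVneq K set0.
    by move=> _ z w; rewrite inE.
  case/(leading_gt0P _ _ K0) => A HA <- z w.
  by rewrite -(e A HA); apply: top_part_eq.
have eq_rank x y : x \in top_part (relpre f leq) A ->
    y \in top_part (relpre f leq) A -> rank s x = rank s y.
  move=> xA yA; case: (h x y) => // eqc _; apply: eqc.
  exact: components_edge (leading_gt0 _ HA) xA yA.
have lt_rank x y : x \in top_part (relpre f leq) A -> y \in A ->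
    y \notin top_part (relpre f leq) A -> (rank s y < rank s x)%N.
  move=> xA yA nyA; case: (h y x) => // _; apply; apply/belowP.
  by exists A.
have [A0|] := eqVneq A set0; first by rewrite A0 !top_part0.
rewrite -(top_part_eq0 f) => /set0Pn[z zA]; apply/setP => x; apply/idP/idP.
  apply: contraLR => nxA; apply/negP => /top_partP[xA hx].
  have /= := hx z; rewrite leqNgt lt_rank //; case/top_partP: zA => zA _.
  by move/(_ zA).
move=> xA; apply/top_partP; split=> [|y yA /=]; first by case/top_partP: xA.
have [yf|nyf] := boolP (y \in top_part (relpre f leq) A).
  by rewrite (eq_rank _ _ yf xA).
exact/ltnW/lt_rank.
Qed.

(** The coefficient of a leading hypergraph in the antipode: the rank f itself
shows that the relation between its components is acyclic. *)
Lemma sum_leading f (H : hypergraph [set: I]) :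
  \sum_(s <- compositions #|I| [set: I]
      | leading (rank_le s) H == leading (relpre f leq) H) (-1) ^+ size s =
  (-1) ^+ #|components (leading (relpre f leq) H)| :> int.
Proof.
under eq_bigl do rewrite leading_adapted.
set G := leading (relpre f leq) H; pose c := pblock (components G).
have /and3P[/eqP cP tiP nP] := components_partition G.
have cT : c @^-1: components G = setT.
  by apply/setP => x; rewrite !inE pblock_mem // cP inE.
have := @sum_adapted I _ c (below f H) f _ _ #|I| (components G).
rewrite cT cardsT; apply=> //.
- move=> x y; apply: components_min; rewrite ?inE // => K.
  have [->|K0] := eqVneq K set0; first by move=> _ z w; rewrite inE.
  by case/(leading_gt0P _ _ K0) => A HA <- z w; apply: top_part_eq.
- by move=> x y /belowP[A [HA xA yA nyA]]; apply: top_part_lt xA yA nyA.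
- apply/subsetP => B BP.
  have /set0Pn[x xB] : B != set0 by apply: contraNneq nP => <-.
  by apply/imsetP; exists x; rewrite // /c (def_pblock tiP BP).
Qed.

End Leading.

(** * The antipode as a sum over leading hypergraphs *)

Section AntipodeFormula.
Set Implicit Arguments.
Unset Strict Implicit.
Variable I : finType.
Implicit Types (S A B : {set I}) (s : seq {set I}).

Lemma HG_mu_Delta (K : fieldType) s S (e : seq_union s = S) (H : hypergraph S) :
  pairwise (fun A B => [disjoint A & B]) s ->
  HG_cast e (HG_mu (HG_Delta (HG_cast (esym e) (HG_basis K H)))) =
  HG_basis K (leading (rank_le s) H).
Proof.
case: _ / e H => H ps.
rewrite /HG_cast /= /HG_basis /HG_Delta /HG_mu liftU scale1r liftU scale1r.
by rewrite /HG_basis iter_union_minors.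
Qed.

(** For the empty set, whose antipode is the identity, the only composition
has no block and H is its own leading hypergraph. *)
Lemma antipodeE (K : fieldType) S (H : hypergraph S) :
  antipode (HG_basis K H) = \sum_(s <- compositions #|S| S)
    (-1) ^+ size s *: HG_basis K (leading (rank_le s) H).
Proof.
rewrite /antipode; case: eqP => [S0|/eqP nS0].
  have -> : compositions #|S| S = [:: [::]] by rewrite S0 cards0 /= eqxx.
  rewrite big_seq1 /= scale1r; congr HG_basis; apply: eq_hypergraph => A A0.
  have h (G : hypergraph S) : G A = 0%N.
    apply/eqP; rewrite -leqn0 leqNgt; apply: contraNN A0 => /mult_sub.
    by rewrite S0 subset0.
  by rewrite !h.
rewrite -[RHS]sum_composition //; apply: eq_bigr => k _; apply: eq_bigr => s _.
rewrite HG_mu_Delta; last by case: s => s /= /and3P[].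
by rewrite size_tuple.
Qed.

(** Grouping the compositions by their leading hypergraph. *)
Lemma antipode_leading (K : fieldType) (H : hypergraph [set: I]) :
  antipode (HG_basis K H) =
  \sum_(G <- undup [seq leading (rank_le s) H | s <- compositions #|I| [set: I]])
    ((-1) ^+ #|components G| : int)%:~R *: HG_basis K G.
Proof.
rewrite antipodeE cardsT.
set cs := compositions _ _; pose lead s := leading (rank_le s) H.
transitivity (\sum_(G <- undup (map lead cs)) \sum_(s <- cs | lead s == G)
    (-1) ^+ size s *: HG_basis K (lead s)).
  under [RHS]eq_bigr do rewrite big_mkcond.
  rewrite exchange_big; apply: eq_big_seq => s s_cs /=.
  rewrite (bigD1_seq (lead s)) ?undup_uniq ?mem_undup ?map_f //= eqxx.
  by rewrite big1 ?addr0 // => G /negbTE; rewrite eq_sym => ->.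
apply: eq_big_seq => G; rewrite mem_undup => /mapP[t _ ->].
rewrite -sum_leading rmorph_sum scaler_suml; apply: eq_bigr => s /eqP <-.
by rewrite rmorphXn rmorphN1.
Qed.

End AntipodeFormula.

(** * Faces of hypergraphic polytopes *)

(* The names set0, setT, ... refer to classical sets from here on. *)
From mathcomp Require Import boolp classical_sets functions cardinality fsbigop.
From mathcomp Require Import interval_inference reals convex.

Local Open Scope classical_set_scope.

Section MinkowskiSums.
Set Implicit Arguments.
Unset Strict Implicit.
Variables (R : realType) (I : finType).
Local Notation RI := {ffun I -> R^o}.
Local Notation "P |+| Q" := (@minkowski_sum R I P Q) (at level 50).
Implicit Types (P Q C : set RI) (A B : {set I}) (y : {linear RI -> R^o}).

Lemma minkowski_sumC : commutative (@minkowski_sum R I).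
Proof.
by move=> P Q; apply/seteqP; split=> _ [a Pa [b Qb <-]]; exists b => //; exists a;
  rewrite // addrC.
Qed.

Lemma minkowski_sumA : associative (@minkowski_sum R I).
Proof.
move=> P Q C; apply/seteqP; split.
  move=> _ [a Pa [_ [b Qb [c Cc <-]] <-]]; exists (a + b).
    by exists a => //; exists b.
  by exists c; rewrite // addrA.
move=> _ [_ [a Pa [b Qb <-]] [c Cc <-]]; exists a => //; exists (b + c).
  by exists b => //; exists c.
by rewrite addrA.
Qed.

Lemma minkowski_sum0 : left_id [set 0] (@minkowski_sum R I).
Proof.
move=> P; apply/seteqP; split=> [_ [_ -> [b Pb <-]]|b Pb]; first by rewrite add0r.
by exists 0 => //; exists b; rewrite ?add0r.
Qed.

HB.instance Definition _ := Monoid.isComLaw.Build (set RI) [set 0]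
  (@minkowski_sum R I) minkowski_sumA minkowski_sumC minkowski_sum0.

(** Repeated multiedges contribute repeated summands. *)
Definition minkowski_power P n := iter n (@minkowski_sum R I P) [set 0].

Lemma minkowski_power_addn P m n : minkowski_power P (m + n) =
  minkowski_power P m |+| minkowski_power P n.
Proof.
elim: m => [|m IHm]; first by rewrite add0n minkowski_sum0.
by rewrite addSn /minkowski_power /= -/(minkowski_power P _) IHm Monoid.mulmA.
Qed.

Lemma minkowski_power_sum (J : finType) (D : pred J) P (F : J -> nat) :
  minkowski_power P (\sum_(j | D j) F j)%N =
  \big[@minkowski_sum R I/[set 0]]_(j | D j) minkowski_power P (F j).
Proof. exact: (big_morph _ (minkowski_power_addn P) (erefl _)). Qed.

Lemma polytopeE (G : hypergraph [set: I]%SET) : polytope R G =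
  \big[@minkowski_sum R I/[set 0]]_(A : {set I} | A != finset.set0)
    minkowski_power (@simplex R I A) (G A).
Proof. by []. Qed.

Definition face y P := [set x | P x /\ forall z, P z -> y z <= y x].

(** A functional is largest at a sum of points exactly if it is largest at
each of them. *)
Lemma face_minkowski_sum y : {morph face y : P Q / P |+| Q}.
Proof.
move=> P Q; apply/seteqP; split=> [x []|x].
  move=> [a Pa [b Qb <-]] maxab; exists a.
    split=> // z Pz; have := maxab (z + b); rewrite !linearD lerD2r; apply.
    by exists z => //; exists b.
  exists b => //; split=> // z Qz; have := maxab (a + z).
  rewrite !linearD lerD2l; apply.
  by exists a => //; exists z.
move=> [a [Pa maxa] [b [Qb maxb] <-]]; split; first by exists a => //; exists b.
by move=> _ [u Pu [v Qv <-]]; rewrite !linearD lerD ?maxa ?maxb.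
Qed.

Lemma face_point y : face y [set 0] = [set 0].
Proof. by apply/seteqP; split=> [x []//|_ ->]; split=> // _ ->. Qed.

Lemma face_minkowski_power y P n :
  face y (minkowski_power P n) = minkowski_power (face y P) n.
Proof.
elim: n => [|n IHn]; first exact: face_point.
by rewrite /minkowski_power /= face_minkowski_sum -/(minkowski_power _ _) IHn.
Qed.

Local Notation e i := (@basis_vector R I i).

Lemma simplex_vertex A i : i \in A -> @simplex R I A (e i).
Proof. by move=> iA; apply: sub_gen_smallest; exists i. Qed.

Lemma simplex_sub A C : @convex_set R RI C -> (forall i, i \in A -> C (e i)) ->
  @simplex R I A `<=` C.
Proof. by move=> cC h; apply: smallest_sub => // _ [i /= iA <-]; exact: h. Qed.

Lemma simplex_convex A : @convex_set R RI (@simplex R I A).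
Proof.
move=> x z k; rewrite !inE => sx sz C [cC AC].
by have := cC x z k; rewrite !inE; apply; [apply: sx | apply: sz].
Qed.

Local Notation RIc := (convex_lmodType RI).
Local Open Scope convex_scope.

Lemma linear_conv y (x z : RIc) (k : {i01 R}) :
  y (x <| k |> z : RIc) = k%:num * y x + (1 - k%:num) * y z.
Proof. by rewrite /conv /= linearD !linearZ. Qed.

Lemma halfspace_convex y (M : R) : @convex_set R RI [set x | y x <= M].
Proof.
move=> x z k; rewrite !inE /= linear_conv => yx yz.
have -> : M = k%:num * M + (1 - k%:num) * M by rewrite -mulrDl addrC subrK mul1r.
by apply: lerD; apply: ler_wpM2l => //; rewrite subr_ge0.
Qed.

Lemma avg_eq_max (k a b M : R) : 0 < k -> k < 1 -> a <= M -> b <= M ->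
  k * a + (1 - k) * b = M -> a = M /\ b = M.
Proof.
move=> k0 k1 aM bM kM.
have : k * (M - a) + (1 - k) * (M - b) = M - (k * a + (1 - k) * b) by ring.
rewrite kM subrr => /eqP.
rewrite paddr_eq0; [|by rewrite mulr_ge0 ?subr_ge0 // ltW..].
rewrite !mulf_eq0 !subr_eq0 => /andP[].
by rewrite gt_eqF // (gt_eqF k1) => /eqP-> /eqP->.
Qed.

(** The inclusion from left to right is the one that needs an argument.  Let
T be the top part of A and M the largest value of y at a vertex.  The points with
y <= M that lie on the simplex of T if y equals M there form a convex set,
because an average of two numbers <= M equals M only if both do; this set
contains the vertices, hence the simplex of A. *)
Lemma face_simplex y A (f : I -> nat) :
  (forall i j, (f i <= f j)%N = (y (e i) <= y (e j))) -> A != finset.set0 ->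
  face y (@simplex R I A) = @simplex R I (top_part (relpre f leq) A).
Proof.
move=> fy A0; set T := top_part _ A.
have /set0Pn[t tT] : T != finset.set0 by rewrite top_part_eq0.
have topP i : i \in A -> y (e i) <= y (e t).
  by move=> iA; case/top_partP: tT => _ /(_ i iA); rewrite /= fy.
have topE i : i \in T -> y (e i) = y (e t).
  move=> /top_partP[iA /(_ t)/= it]; apply/le_anti; rewrite topP //= -fy it //.
  by case/top_partP: tT.
apply/seteqP; split.
  pose C := [set x : RI | y x <= y (e t) /\ (y x = y (e t) -> @simplex R I T x)].
  have AC : @simplex R I A `<=` C.
    apply: simplex_sub => [|i iA].
      apply/convex_setW => x z; rewrite !inE => -[lex ex] [lez ez] k k0 k1.
      rewrite inE; split.
        by have := @halfspace_convex y (y (e t)) x z k; rewrite !inE; apply.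
      rewrite linear_conv => /avg_eq_max[]// /ex Tx /ez Tz.
      by have := @simplex_convex T x z k; rewrite !inE; apply.
    split=> [|eyi]; first exact: topP.
    apply: simplex_vertex; apply/top_partP; split=> // j jA.
    by rewrite /= fy eyi topP.
  move=> x [Ax maxx]; case: (AC x Ax) => lex; apply.
  apply/le_anti; rewrite lex maxx //; apply: simplex_vertex.
  by case/top_partP: tT.
move=> x Tx; have [Ax yx] : @simplex R I A x /\ y x = y (e t).
  pose C := [set x : RI | @simplex R I A x /\ y x = y (e t)].
  move: x Tx; apply: (simplex_sub (C := C)).
    move=> x z k; rewrite !inE => -[Ax yx] [Az yz]; split.
      by have := @simplex_convex A x z k; rewrite !inE; apply.
    by rewrite linear_conv yx yz -mulrDl addrC subrK mul1r.
  by move=> i iT; rewrite /C /= topE //; split=> //; case/top_partP: iT => iA _;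
    apply: simplex_vertex.
split=> // z; rewrite yx; move: z.
exact: (simplex_sub (@halfspace_convex y (y (e t)))).
Qed.

Lemma face_polytope y (f : I -> nat) (H : hypergraph [set: I]%SET) :
  (forall i j, (f i <= f j)%N = (y (e i) <= y (e j))) ->
  face y (polytope R H) = polytope R (leading (relpre f leq) H).
Proof.
move=> fy; rewrite !polytopeE (big_morph _ (face_minkowski_sum y) (face_point y)).
rewrite (partition_big (top_part (relpre f leq)) (fun K => K != finset.set0)) /=;
  last by move=> A; rewrite top_part_eq0.
apply: eq_bigr => K K0; rewrite leadingE // minkowski_power_sum.
apply: eq_big => [A|A].
  by rewrite -(top_part_eq0 f); case: (_ =P K) => [->|]; rewrite ?andbF // K0.
by case/andP=> A0 /eqP <-; rewrite face_minkowski_power (face_simplex fy).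
Qed.

Lemma polytope_neq0 (G : hypergraph [set: I]%SET) : polytope R G !=set0.
Proof.
rewrite polytopeE; apply: (big_ind (fun P => P !=set0)); first by exists 0.
  by move=> P Q [a Pa] [b Qb]; exists (a + b), a => //; exists b.
move=> A /finset.set0Pn[i iA]; elim: (G A) => [|n [b Pb]]; first by exists 0.
by exists (e i + b), (e i); [exact: simplex_vertex | exists b].
Qed.

Definition is_max y P (v : R) :=
  (exists2 x, P x & y x = v) /\ forall x, P x -> y x <= v.

Lemma is_max_unique y P v w : is_max y P v -> is_max y P w -> v = w.
Proof.
move=> [[a Pa <-] maxa] [[b Pb <-] maxb].
by apply/le_anti; rewrite maxa // maxb.
Qed.

Lemma is_max_sum y P Q v w :
  is_max y P v -> is_max y Q w -> is_max y (P |+| Q) (v + w).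
Proof.
move=> [[a Pa <-] maxa] [[b Qb <-] maxb]; split.
  by exists (a + b); rewrite ?linearD //; exists a => //; exists b.
by move=> _ [c Pc [d Qd <-]]; rewrite linearD lerD ?maxa ?maxb.
Qed.

Lemma is_max_point y : is_max y [set 0] 0.
Proof. by split=> [|_ ->]; [exists 0 => // | ]; rewrite linear0. Qed.

Lemma is_max_minkowski_power y P v n :
  is_max y P v -> is_max y (minkowski_power P n) (v *+ n).
Proof.
move=> Pv; elim: n => [|n IHn]; first exact: is_max_point.
by rewrite mulrS; exact: is_max_sum.
Qed.

Definition weight (h : I -> R) (x : RI) : R^o := \sum_i h i * x i.

Fact weight_linear h : linear (weight h).
Proof.
move=> a x z; rewrite /weight scaler_sumr -big_split /=; apply: eq_bigr => i _.
by rewrite !ffunE /= /GRing.scale /=; ring.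
Qed.

HB.instance Definition _ h :=
  GRing.isLinear.Build R RI R^o _ (weight h) (weight_linear h).

Lemma weight_vertex h i : weight h (e i) = h i.
Proof.
rewrite /weight (bigD1 i) //= ffunE eqxx mulr1 big1 ?addr0 // => j ji.
by rewrite ffunE eq_sym (negbTE ji) mulr0.
Qed.

(** Half-spaces in these directions recover the multiplicities: the maximum
on the simplex of A is -1 if A is contained in B, and 0 otherwise. *)
Definition avoid B i : R := - (i \in B)%:R.

Lemma is_max_simplex A B : A != finset.set0 ->
  is_max (weight (avoid B)) (@simplex R I A) (- (A \subset B)%:R).
Proof.
move=> A0; have [i iA Ai] : exists2 i, i \in A & avoid B i = - (A \subset B)%:R.
  have [AB|/subsetPn[i iA iB]] := boolP (A \subset B); last first.
    by exists i; rewrite // /avoid (negbTE iB).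
  have /finset.set0Pn[i iA] := A0; exists i; rewrite // /avoid.
  by rewrite (fintype.subsetP AB).
split; first by exists (e i); [exact: simplex_vertex | rewrite /= weight_vertex].
apply: (simplex_sub (@halfspace_convex (weight (avoid B)) (- (A \subset B)%:R))).
move=> j jA.
rewrite /= weight_vertex lerN2.
case: (boolP (A \subset B)) => [AB|_]; last by rewrite ler0n.
by rewrite (fintype.subsetP AB).
Qed.

(** Maxima of a functional add up over Minkowski sums. *)
Lemma is_max_polytope (G : hypergraph [set: I]%SET) B :
  is_max (weight (avoid B)) (polytope R G)
    (- (\sum_(A : {set I} | (A != finset.set0) && (A \subset B)) G A)%:R).
Proof.
have -> : - (\sum_(A : {set I} | (A != finset.set0) && (A \subset B)) G A)%:R
   = \sum_(A : {set I} | A != finset.set0) (- (A \subset B)%:R) *+ G A :> R.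
  rewrite natr_sum big_mkcondr -sumrN /=; apply: eq_bigr => A _.
  by rewrite mulNrn; case: ifP => _; rewrite ?mul0rn ?oppr0.
rewrite polytopeE; apply: (big_ind2 (is_max (weight (avoid B)))).
- exact: is_max_point.
- by move=> P v Q w; exact: is_max_sum.
- by move=> A A0; apply/is_max_minkowski_power/is_max_simplex.
Qed.

(** The support function gives for every B the number of nonempty edges
contained in B; the multiplicities follow by induction on the size of B. *)
Lemma polytope_inj : injective (@polytope R I).
Proof.
move=> G H eGH; apply: eq_hypergraph => B.
have sumE (C : {set I}) :
    (\sum_(A : {set I} | (A != finset.set0) && (A \subset C)) G A =
    \sum_(A : {set I} | (A != finset.set0) && (A \subset C)) H A)%N.
  apply/eqP; rewrite -(eqr_nat R) -eqr_opp; apply/eqP.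
  apply: is_max_unique (is_max_polytope G C) _.
  by rewrite eGH; exact: is_max_polytope.
have [n] := ubnP #|B|; elim: n B => // n IHn B; rewrite ltnS => leB B0.
have := sumE B; rewrite (bigD1 B) ?B0 //= [RHS](bigD1 B) ?B0 //=.
rewrite [X in (G B + X)%N](eq_bigr H) => [/addIn//|A /andP[/andP[A0 AB] nAB]].
apply: IHn => //; apply: leq_trans leB; apply: proper_card.
by rewrite finset.properEneq nAB.
Qed.

Lemma hypergraph_ofK : cancel (@polytope R I) (@hypergraph_of R I).
Proof.
move=> G; apply: polytope_inj; rewrite /hypergraph_of.
by case: xgetP => [G' -> //|/(_ G)]; case.
Qed.

Definition leadings (H : hypergraph [set: I]%SET) :=
  undup [seq leading (rank_le s) H | s <- compositions #|I| [set: I]%SET].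

(** A functional y selects the composition of I sorted by the values of y, and a
composition is selected by the functional whose coefficients are the ranks. *)
Lemma facesE (H : hypergraph [set: I]%SET) :
  nonempty_faces (polytope R H) = @polytope R I @` [set` leadings H].
Proof.
apply/seteqP; split=> [F [[y ->] _]|_ [G GH <-]].
  have [s cs rs] := exists_rank (fun i => y (e i)) [set: I]%SET.
  have fy i j : (rank s i <= rank s j)%N = (y (e i) <= y (e j)).
    by rewrite -rank_leE rs ?finset.inE.
  rewrite -/(face y _) (face_polytope _ fy); exists (leading (rank_le s) H) => //.
  rewrite /= mem_undup; apply: (map_f (fun s => leading (rank_le s) H)).
  by rewrite mem_compositions ?cardsT.
split; last exact: polytope_neq0.
move: GH; rewrite /= mem_undup => /mapP[s _ ->].
exists (weight (fun i => (rank s i)%:R)); rewrite -/(face _ _).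
rewrite (face_polytope (f := rank s)) // => i j.
by rewrite /= !weight_vertex ler_nat.
Qed.

End MinkowskiSums.

Theorem theorem20p5 (K : fieldType) (charK : [pchar K] =i pred0)
    (R : realType) (I : finType) (H : hypergraph [set: I]%SET) :
  let faces := nonempty_faces (polytope R H) in
  let coef := fun F : set {ffun I -> R^o} =>
    (-1) ^+ #|components (hypergraph_of F)| : int in
  [/\ finite_set faces,
      forall F, faces F -> exists! G : hypergraph [set: I]%SET, polytope R G = F,
      antipode (HG_basis K H) =
        \sum_(F \in faces) (coef F)%:~R *: HG_basis K (hypergraph_of F),
      cancellation_free faces coef (@hypergraph_of R I)
    & grouping_free faces (@hypergraph_of R I)].
Proof.
move=> faces coef.
have facesP F : faces F -> polytope R (hypergraph_of F) = F.
  by rewrite /faces facesE => -[G _ <-]; rewrite hypergraph_ofK.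
have ofI F F' : faces F -> faces F' -> F <> F' ->
    hypergraph_of F <> hypergraph_of F'.
  by move=> fF fF' nFF' e; apply: nFF'; rewrite -(facesP F) // e facesP.
split=> [|F fF||F F' fF fF' nFF' e|//].
- by rewrite /faces facesE; apply/finite_image/finite_seq.
- exists (hypergraph_of F); split; first exact: facesP.
  by move=> G <-; rewrite hypergraph_ofK.
- rewrite antipode_leading /faces facesE fsbig_image; last first.
    by move=> G G' _ _; exact: polytope_inj.
  rewrite -fsbig_seq ?undup_uniq //; apply: eq_bigr => G _.
  by rewrite /coef hypergraph_ofK.
- by case: (ofI F F').
Qed.
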